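(* Let $p\in[0,1]$. Consider a random infinite walk in the tree $\mathbf{T}_{(1,1)}$, starting at the root pair $(1,1)$, in which at each step, independently, a right branch is chosen with probability $p$ and a left branch with probability $1-p$. Then the probability that the walk does not contain any $(1,1)$ pair except the one at the root is $0$ if $p\le 1/3$, and is $$\frac{3p-2+\sqrt{4p-3p^2}}{2}$$ if $p>1/3$.
   Context: The tree $\mathbf{T}_{(1,1)}$: the root carries the number $1$ and has a single child carrying the number $1$. Recursively, if $x$ is the parent of $y$, then $y$ has two children: $|x-y|$ (left branch) and $x+y$ (right branch). A walk starting at the root is thus a sequence $g_0=1,g_1=1,g_2,g_3,\dots$ where, for each $n\ge 1$, $g_{n+1}=|g_{n-1}-g_n|$ if the chosen branch is left and $g_{n+1}=g_{n-1}+g_n$ if it is right. The walk contains a pair $(1,1)$ other than at the root if $(g_n,g_{n+1})=(1,1)$ for some $n\ge 1$. *)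

(* Defs.v *)
From mathcomp Require Import all_boot all_order all_algebra finmap.
From mathcomp Require Import all_classical all_reals all_analysis.

Set Implicit Arguments.
Unset Strict Implicit.
Unset Printing Implicit Defensive.

Import Order.TTheory GRing.Theory Num.Theory.

Local Open Scope classical_set_scope.

(* [step m] is the branch taken from the pair (g_m, g_(m+1)): [true] is right,
   [false] is left. The distance on nat is used since [-] truncates there. *)
Fixpoint walk (step : nat -> bool) (n : nat) : nat :=
  match n with
  | 0 => 1
  | 1 => 1
  | (m.+1 as k).+1 =>
      if step m then walk step m + walk step k
      else `|walk step m - walk step k|
  end%N.

Definition contains_11_after_root (step : nat -> bool) : Prop :=
  exists2 n : nat, (1 <= n)%N & (walk step n, walk step n.+1) = (1%N, 1%N).

(* Mutual independence of a family of random variables: the product rule for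
   every finite subfamily. *)
Definition mutually_independent (d d' : measure_display) (T : measurableType d)
    (T' : measurableType d') (R : realType) (P : probability T R)
    (I : choiceType) (X : I -> {RV P >-> T'}) : Prop :=
  forall (J : {fset I}) (A : I -> set T'), (forall i, measurable (A i)) ->
    P (\bigcap_(i in [set` J]) (X i @^-1` A i)) =
    (\prod_(i <- J) P (X i @^-1` A i))%E.

(* Main.v *)
Require Import Defs.
From mathcomp Require Import all_boot all_order all_algebra finmap ring lra.
From mathcomp Require Import all_classical all_reals all_analysis.

Import Order.TTheory GRing.Theory Num.Theory.
Import numFieldNormedType.Exports.
Local Open Scope classical_set_scope.
Local Open Scope ring_scope.

(* The move R L L acts trivially on pairs. Cancelling it, the walk is described
   by a stack of blocks R and RL. Giving R weight 2 and RL weight 1, a right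
   branch adds 2 to the total weight and a left branch subtracts 1. Every block
   increases the sum of a pair of positive numbers, so the pair is (1, 1) exactly
   when the stack is empty, i.e. when the weight is 0; a walk starting with a left
   branch comes back to (1, 1) whatever it does next. Hence the probability is
   p U(2), where U(h) is the probability that the +2/-1 walk started at h never
   hits 0. Summing U(h) = p U(h + 2) + (1 - p) U(h - 1) over h gives
   (3p - 1) lim U = p (U(1) + U(2)). If p <= 1/3 both sides vanish. Otherwise
   U(h) >= 1 - q^h, where q < 1 is the root of q = (1 - p) + p q^3 with
   p q^2 + p q = 1 - p; so lim U = 1 and these bounds are equalities for
   h = 1, 2. *)

(** * Deterministic walks: from pairs to heights *)

(** [m] is the index of the next branch, [n] the number of branches still to be read, [h] the
    current height. *)
Fixpoint stays_positive (step : nat -> bool) (m n h : nat) : bool :=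
  match h, n with
  | 0, _ => false
  | _.+1, 0 => true
  | k.+1, n'.+1 => stays_positive step m.+1 n' (if step m then k.+3 else k)
  end%N.

Lemma stays_positive_pred (step : nat -> bool) (m n h : nat) :
  stays_positive step m n.+1 h -> stays_positive step m n h.
Proof. by elim: n m h => [|n IH] m [|h] // sp; exact: IH sp. Qed.

(* A stack of blocks, [false] standing for R and [true] for RL, acting on the
   root pair; the block at the head acts last. *)
Fixpoint block_pair (s : seq bool) : nat * nat :=
  if s is b :: s' then
    let: (x, y) := block_pair s' in if b then (x + y, x)%N else (y, x + y)%N
  else (1, 1)%N.

Definition block_height (s : seq bool) : nat :=
  sumn [seq (if b then 1 else 2)%N | b <- s].

Lemma walkSS (step : nat -> bool) (m : nat) :
  walk step m.+2 = (if step m then walk step m + walk step m.+1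
                    else `|walk step m - walk step m.+1|)%N.
Proof. by []. Qed.

Lemma block_pair_gt0 (s : seq bool) :
  (0 < (block_pair s).1)%N && (0 < (block_pair s).2)%N.
Proof.
elim: s => //= b s; case: (block_pair s) => x y /= /andP[x0 y0].
by case: b => /=; rewrite ?addn_gt0 ?x0 ?y0.
Qed.

(** A block on top makes one entry a sum of two positive numbers, hence at least 2. *)
Lemma block_pair_eq11 (s : seq bool) :
  (block_pair s == (1, 1)%N) = (block_height s == 0%N).
Proof.
case: s => [|b s] //=; have := block_pair_gt0 s.
case: (block_pair s) => -[|x] [|y] //= _.
by case: b; rewrite xpair_eqE addnS //= andbF.
Qed.

(** Every branch taken from a nonempty stack leads to a stack: right pushes R, left turns a top R
    into RL and removes a top RL. The height moves by +2 or -1 accordingly. *)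
Lemma stays_positiveP (step : nat -> bool) (n m : nat) (s : seq bool) :
  (walk step m, walk step m.+1) = block_pair s ->
  stays_positive step m n (block_height s) <->
  (forall k, (k <= n)%N ->
    (walk step (m + k), walk step (m + k).+1) <> (1, 1)%N).
Proof.
elim: n m s => [|n IH] m s ms.
  have -> : stays_positive step m 0 (block_height s) = (block_height s != 0%N).
    by case: (block_height s).
  rewrite -block_pair_eq11 -ms; split => [/eqP h k|h].
    by rewrite leqn0 => /eqP ->; rewrite addn0.
  by apply/eqP => e; apply: (h 0%N) => //; rewrite addn0.
have [hs0|hs0] := eqVneq (block_height s) 0%N.
  rewrite hs0 /=; split => // h; exfalso; apply: (h 0%N) => //.
  by rewrite addn0 ms; apply/eqP; rewrite block_pair_eq11 hs0.
have [t [mt ->]] : exists t,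
    (walk step m.+1, walk step m.+2) = block_pair t /\
    stays_positive step m n.+1 (block_height s) =
    stays_positive step m.+1 n (block_height t).
  rewrite walkSS; case sm : (step m).
    exists (false :: s); rewrite /= -ms; split=> //.
    have -> : block_height (false :: s) = (block_height s).+2 by [].
    by move: hs0; case: (block_height s) => //= k _; rewrite sm.
  case: s ms hs0 => // -[] s /= ms _.
    (* Top block RL: the left branch completes R L L, which cancels. *)
    exists s; rewrite sm; split=> //; move: ms.
    case: (block_pair s) => x y [-> ->]; congr pair.
    by rewrite distnEl ?leq_addr // addKn.
  (* Top block R: it becomes RL. *)
  exists (true :: s); rewrite /= sm; split=> //; move: ms.
  case: (block_pair s) => x y [-> ->]; congr pair.
  by rewrite distnEr ?leq_addl // addnK.
rewrite (IH _ _ mt); split => h k kn.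
  case: k kn => [_|k kn]; last by rewrite addnS -addSn; exact: h.
  by rewrite addn0 ms => /eqP; rewrite block_pair_eq11 (negbTE hs0).
by rewrite addSn -addnS; exact: h.
Qed.

Lemma avoids_11P (step : nat -> bool) :
  ~ contains_11_after_root step <->
  step 0%N /\ forall n, stays_positive step 1 n 2.
Proof.
case s0 : (step 0%N); last first.
  (* After a left first branch the walk reads 1, 1, 0, 1, 1 whatever the next two branches are. *)
  split=> [|[]//]; case; exists 3%N => //.
  have w2 : walk step 2 = 0%N by rewrite walkSS s0.
  have w3 : walk step 3 = 1%N by rewrite walkSS w2; case: ifP.
  by rewrite (walkSS _ 2) w3 w2; case: ifP.
(* A right first branch leaves the single block R, of height 2. *)
have P1 : (walk step 1, walk step 2) = block_pair [:: false].
  by rewrite walkSS s0.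
split=> [h|[_ h] [n n0 en]].
  split=> // n; apply/(stays_positiveP _ n _ _ P1) => k _ e.
  by apply: h; exists (1 + k)%N.
have /(stays_positiveP _ n.-1 _ _ P1)/(_ n.-1 (leqnn _)) := h n.-1.
by rewrite add1n prednK.
Qed.

(** * Survival probabilities of the +2/-1 walk *)

Fixpoint survival {R : realType} (p : R) (n h : nat) : R :=
  match h, n with
  | 0%N, _ => 0
  | _.+1, 0%N => 1
  | k.+1, n'.+1 => p * survival p n' k.+3 + (1 - p) * survival p n' k
  end.

Section survival_theory.
Context {R : realType} (p : R).
Hypothesis p01 : 0 <= p <= 1.
Local Notation u := (survival p).

Let p0 : 0 <= p. Proof. by case/andP: p01. Qed.
Let q0 : 0 <= 1 - p. Proof. by case/andP: p01; rewrite subr_ge0. Qed.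

Lemma survival0 (n : nat) : u n 0 = 0. Proof. by case: n. Qed.

Lemma survivalS (n h : nat) :
  u n.+1 h.+1 = p * u n h.+3 + (1 - p) * u n h.
Proof. by []. Qed.

Lemma survival_ge0 (n h : nat) : 0 <= u n h.
Proof.
elim: n h => [|n IH] [|h] //=.
by rewrite addr_ge0 // mulr_ge0.
Qed.

Lemma survival_le1 (n h : nat) : u n h <= 1.
Proof.
elim: n h => [|n IH] [|h] //=.
have := ler_wpM2l p0 (IH h.+3); have := ler_wpM2l q0 (IH h); lra.
Qed.

Lemma survival_nondecreasing_height (n h : nat) : u n h <= u n h.+1.
Proof.
elim: n h => [|n IH] [|h] //=.
  by rewrite addr_ge0 // mulr_ge0 // survival_ge0.
by rewrite lerD // ler_wpM2l.
Qed.

Lemma survivalS_le (n h : nat) : u n.+1 h <= u n h.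
Proof.
elim: n h => [|n IH] [|h] //; first exact: (survival_le1 1 h.+1).
by rewrite [leLHS]survivalS [leRHS]survivalS lerD // ler_wpM2l.
Qed.

(** The equation for [q] says that [1 - q ^+ h] satisfies the recursion of [survival]; it vanishes
    at height 0 and is at most 1, so the bound propagates in [n]. *)
Lemma survival_ge (q : R) : 0 <= q -> q = (1 - p) + p * q ^+ 3 ->
  forall n h, 1 - q ^+ h <= u n h.
Proof.
move=> q_ge0 qE; elim=> [|n IH] [|h] /=; rewrite ?expr0 ?subrr //.
  by rewrite gerBl exprn_ge0.
have := ler_wpM2l p0 (IH h.+3); have := ler_wpM2l q0 (IH h).
have -> : q ^+ h.+1 = (1 - p) * q ^+ h + p * q ^+ h.+3.
  by rewrite exprS {1}qE !exprS; ring.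
lra.
Qed.

Definition eternal_survival (h : nat) : R := limn (u ^~ h).
Local Notation U := eternal_survival.

Lemma cvg_survival (h : nat) : u ^~ h @ \oo --> U h.
Proof.
apply: nonincreasing_is_cvgn.
  by apply/nonincreasing_seqP => n; exact: survivalS_le.
by exists 0 => _ [n _ <-]; exact: survival_ge0.
Qed.

Lemma eternal_survival0 : U 0 = 0.
Proof.
apply/cvg_lim => //; rewrite (_ : u ^~ 0%N = cst 0); first exact: cvg_cst.
by apply/funext => n; rewrite survival0.
Qed.

Lemma eternal_survival_harmonic (h : nat) :
  U h.+1 = p * U h.+3 + (1 - p) * U h.
Proof.
apply/cvg_lim => //; rewrite -cvg_shiftS /=.
by apply: cvgD; apply: cvgM; [exact: cvg_cst|exact: cvg_survival..|
  exact: cvg_cst|exact: cvg_survival].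
Qed.

Lemma eternal_survival_ge0 (h : nat) : 0 <= U h.
Proof.
apply: limr_ge; first exact: cvgP (cvg_survival h).
by apply: nearW => n; exact: survival_ge0.
Qed.

Lemma eternal_survival_le1 (h : nat) : U h <= 1.
Proof.
apply: limr_le; first exact: cvgP (cvg_survival h).
by apply: nearW => n; exact: survival_le1.
Qed.

Lemma eternal_survival_ge (q : R) : 0 <= q -> q = (1 - p) + p * q ^+ 3 ->
  forall h, 1 - q ^+ h <= U h.
Proof.
move=> q_ge0 qE h; apply: limr_ge; first exact: cvgP (cvg_survival h).
by apply: nearW => n; exact: survival_ge.
Qed.

Lemma eternal_survival_nondecreasing : nondecreasing_seq U.
Proof.
apply/nondecreasing_seqP => h; apply: ler_lim.
- exact: cvgP (cvg_survival h).
- exact: cvgP (cvg_survival h.+1).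
- by apply: nearW => n; exact: survival_nondecreasing_height.
Qed.

Lemma is_cvg_eternal_survival : cvgn U.
Proof.
apply: nondecreasing_is_cvgn; first exact: eternal_survival_nondecreasing.
by exists 1 => _ [h _ <-]; exact: eternal_survival_le1.
Qed.

(* Harmonicity summed over the heights up to [h] telescopes. *)
Lemma eternal_survival_sum (h : nat) :
  (1 - p) * U h = p * (U h.+1 + U h.+2 - U 1 - U 2).
Proof.
elim: h => [|h IH]; first by rewrite eternal_survival0; ring.
have := eternal_survival_harmonic h.+1.
have := eternal_survival_harmonic h; lra.
Qed.

(** Limit of the telescoped sum as the height tends to infinity. *)
Lemma eternal_survival_flux :
  (3 * p - 1) * limn U = p * (U 1 + U 2).
Proof.
have Ul : U @ \oo --> limn U := is_cvg_eternal_survival.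
have lhs : (fun h => (1 - p) * U h) @ \oo --> (1 - p) * limn U.
  by apply: cvgM => //; exact: cvg_cst.
have rhs : (fun h => (1 - p) * U h) @ \oo -->
    p * (limn U + limn U - U 1 - U 2).
  rewrite (_ : (fun _ => _) = fun h => p * (U h.+1 + U h.+2 - U 1 - U 2)).
    apply: cvgM; first exact: cvg_cst.
    apply: cvgB; last exact: cvg_cst.
    apply: cvgB; last exact: cvg_cst.
    apply: cvgD; first by rewrite cvg_shiftS.
    by rewrite (cvg_shiftS (fun h => U h.+1)) cvg_shiftS.
  by apply/funext => h; exact: eternal_survival_sum.
have E : (1 - p) * limn U = p * (limn U + limn U - U 1 - U 2).
  exact: cvg_unique lhs rhs.
lra.
Qed.

Lemma eternal_survival2 :
  p * U 2 = if p <= 1 / 3 then 0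
            else (3 * p - 2 + Num.sqrt (4 * p - 3 * p ^+ 2)) / 2.
Proof.
have Uge := eternal_survival_ge0; have flux := eternal_survival_flux.
have Ul := is_cvg_eternal_survival.
have := p01 => /andP[_ p1].
case: ifPn => [p13|].
  have Ul0 : 0 <= limn U by apply: limr_ge => //; exact: nearW.
  have := mulr_ge0 p0 (Uge 1%N); have := mulr_ge0 p0 (Uge 2%N).
  (* The flux is now at most 0, yet it is a sum of two nonnegative terms. *)
  have : 0 <= (1 - 3 * p) * limn U by rewrite mulr_ge0 //; lra.
  lra.
rewrite -ltNge => p13.
set s : R := Num.sqrt _; have p_gt0 : 0 < p by lra.
have D0 : 0 <= 4 * p - 3 * p ^+ 2.
  rewrite (_ : _ - _ = p * (4 - 3 * p)); last by ring.
  by rewrite mulr_ge0 //; lra.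
have ss : s ^+ 2 = 4 * p - 3 * p ^+ 2 by rewrite sqr_sqrtr.
have ps : p <= s.
  rewrite -(ger0_norm p0) -sqrtr_sqr ler_wsqrtr //.
  have := mulr_ge0 p0 q0; lra.
have s3p : s < 3 * p.
  rewrite -[ltRHS]ger0_norm; last by lra.
  rewrite -sqrtr_sqr ltr_sqrt ?exprn_gt0 //; last by lra.
  have : 0 < p * (3 * p - 1) by rewrite mulr_gt0 //; lra.
  lra.
(* Nonnegative root of [p * q ^+ 2 + p * q = 1 - p], whose discriminant is [s ^+ 2]; the bounds on
   [s] place it in [0, 1). *)
pose q : R := (s - p) / (2 * p).
have q_ge0 : 0 <= q by rewrite divr_ge0 //; lra.
have q_lt1 : q < 1 by rewrite ltr_pdivrMr; lra.
have qpE : 2 * (p * q) = s - p by rewrite /q; field; rewrite gt_eqF.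
have qE2 : p * q ^+ 2 + p * q = 1 - p.
  apply: (mulfI (lt0r_neq0 p_gt0)).
  have : (2 * (p * q)) ^+ 2 = s ^+ 2 - 2 * s * p + p ^+ 2.
    by rewrite qpE; ring.
  have : p * (2 * (p * q)) = p * (s - p) by rewrite qpE.
  rewrite ss; lra.
(* The cubic is [q - 1] times the quadratic. *)
have qE : q = (1 - p) + p * q ^+ 3.
  have : q * (p * q ^+ 2 + p * q) = q * (1 - p) by rewrite qE2.
  by rewrite -[in X in _ = X + _]qE2; lra.
have Uq := eternal_survival_ge q q_ge0 qE.
have U1 : limn U = 1.
  apply: le_anti; apply/andP; split.
    by apply: limr_le => //; apply: nearW => h; exact: eternal_survival_le1.
  have : (fun h => 1 - q ^+ h) @ \oo --> (1 - 0 : R).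
    apply: cvgB; first exact: cvg_cst.
    by apply: cvg_expr; rewrite ger0_norm.
  by rewrite subr0 => /ler_cvg_to; apply; [exact: Ul|exact: nearW].
(* Times [p], the lower bounds at heights 1 and 2 add up to [2 * p - (1 - p)], which is the flux.
   Both are thus equalities, and [p * U 2 = p - p * q ^+ 2] follows. *)
move: flux; rewrite U1.
have := ler_wpM2l p0 (Uq 1%N); have := ler_wpM2l p0 (Uq 2%N); lra.
Qed.

End survival_theory.

(** * Probabilities of events on random branches *)

Section step_probability.
Context {R : realType} (p : R) {d : measure_display} {T : measurableType d}
  {P : probability T R} (step : nat -> {RV P >-> bool}).
Hypothesis step_indep : mutually_independent step.
Hypothesis step_right : forall n, P (step n @^-1` [set true]) = p%:E.
Hypothesis step_left : forall n, P (step n @^-1` [set false]) = (1 - p)%:E.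

Definition cylinder (s : seq bool) : set T :=
  [set w | forall i, (i < size s)%N -> step i w = nth false s i].

(** The shape to which the product rule of [mutually_independent] applies. *)
Lemma cylinderE (s : seq bool) : cylinder s =
  \bigcap_(i in [set` [fset i | i in iota 0 (size s)]%fset])
    (step i @^-1` [set nth false s i]).
Proof.
apply/seteqP; split=> w /= h i; first by rewrite /= inE mem_iota => /h.
by move=> si; apply: (h i); rewrite /= inE mem_iota.
Qed.

Lemma measurable_step (n : nat) (b : bool) :
  measurable (step n @^-1` [set b]).
Proof. by apply: measurable_funPTI. Qed.

Lemma measurable_cylinder (s : seq bool) : measurable (cylinder s).
Proof.
rewrite cylinderE; apply: fin_bigcap_measurable => // i _.
exact: measurable_step.
Qed.

Lemma probability_cylinder (s : seq bool) :
  P (cylinder s) = (\prod_(i < size s) (if nth false s i then p else 1 - p))%:E.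
Proof.
rewrite cylinderE (step_indep _ (fun i => [set nth false s i])) //.
rewrite (perm_big (iota 0 (size s))) /=; last first.
  apply: uniq_perm; rewrite ?fset_uniq ?iota_uniq // => i.
  by rewrite inE.
rewrite -prodEFin.
rewrite -(big_mkord xpredT (fun i => (if nth false s i then p else 1 - p)%:E)).
rewrite /index_iota subn0; apply: eq_bigr => i _.
by case: (nth _ _ _).
Qed.

Lemma cylinder_rcons (s : seq bool) (b : bool) :
  cylinder (rcons s b) = cylinder s `&` step (size s) @^-1` [set b].
Proof.
apply/seteqP; split=> w /=.
  move=> h; split => [i si|].
    by rewrite h ?size_rcons ?ltnS 1?ltnW // nth_rcons si.
  by rewrite h ?size_rcons // nth_rcons ltnn eqxx.
move=> [h1 h2] i; rewrite size_rcons ltnS nth_rcons leq_eqVlt.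
move=> /orP[/eqP ->|si].
  by rewrite ltnn eqxx.
by rewrite si h1.
Qed.

Lemma probability_cylinder_rcons (s : seq bool) (b : bool) :
  P (cylinder (rcons s b)) = ((if b then p else 1 - p)%:E * P (cylinder s))%E.
Proof.
rewrite !probability_cylinder size_rcons big_ord_recr /= nth_rcons ltnn eqxx.
rewrite mulrC EFinM; congr (_ * _%:E)%E.
by apply: eq_bigr => i _; rewrite nth_rcons ltn_ord.
Qed.

Local Notation stays m n h :=
  [set w | stays_positive (step ^~ w) m n h].

Lemma stays_positive_split (m n k : nat) : stays m n.+1 k.+1 =
  (step m @^-1` [set true] `&` stays m.+1 n k.+3) `|`
  (step m @^-1` [set false] `&` stays m.+1 n k).
Proof.
by apply/seteqP; split=> w /=; case: (step m w); intuition.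
Qed.

Lemma measurable_stays_positive (m n h : nat) : measurable (stays m n h).
Proof.
elim: n m h => [|n IH] m [|h].
- by rewrite (_ : [set _ | _] = set0) // -subset0.
- by rewrite (_ : [set _ | _] = setT) // -subTset.
- by rewrite (_ : [set _ | _] = set0) // -subset0.
by rewrite stays_positive_split; apply: measurableU; apply: measurableI => //;
  exact: measurable_step.
Qed.

(** Markov property: survival after a prescribed prefix depends only on the height. Splitting on the
    next branch lengthens the prefix, so the induction on [n] runs over all [s]. *)
Lemma probability_stays_positive (s : seq bool) (n h : nat) :
  P (cylinder s `&` stays (size s) n h) =
  (P (cylinder s) * (survival p n h)%:E)%E.
Proof.
elim: n s h => [|n IH] s [|h].
- by rewrite (_ : stays _ _ _ = set0) ?setI0 ?measure0 ?mule0 // -subset0.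
- by rewrite (_ : stays _ _ _ = setT) ?setIT ?mule1 // -subTset.
- by rewrite (_ : stays _ _ _ = set0) ?setI0 ?measure0 ?mule0 // -subset0.
rewrite stays_positive_split setIUr !setIA -!cylinder_rcons.
have mC b k : measurable (cylinder (rcons s b) `&` stays (size s).+1 n k).
  apply: measurableI; first exact: measurable_cylinder.
  exact: measurable_stays_positive.
rewrite measureU //; last first.
  (* The two pieces disagree on the branch of index [size s]. *)
  apply/seteqP; split=> // w [[+ _] [+ _]]; rewrite !cylinder_rcons.
  by move=> [_ /= ->] [_].
have PC b k : P (cylinder (rcons s b) `&` stays (size s).+1 n k) =
    ((if b then p else 1 - p)%:E * P (cylinder s) * (survival p n k)%:E)%E.
  by have := IH (rcons s b) k; rewrite size_rcons probability_cylinder_rcons.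
apply: etrans; first exact: congr2 (PC true h.+3) (PC false h).
rewrite /= probability_cylinder -!EFinM -EFinD; congr _%:E; ring.
Qed.

End step_probability.

Theorem theorem1p7 (R : realType) (p : R) (hp : 0 <= p <= 1)
    (d : measure_display) (T : measurableType d) (P : probability T R)
    (step : nat -> {RV P >-> bool})
    (step_indep : mutually_independent step)
    (step_right : forall n, P (step n @^-1` [set true]) = p%:E)
    (step_left : forall n, P (step n @^-1` [set false]) = (1 - p)%:E) :
  P [set w | ~ contains_11_after_root (fun n => step n w)] =
    (if p <= 1 / 3 then 0
     else (3 * p - 2 + Num.sqrt (4 * p - 3 * p ^+ 2)) / 2)%:E.
Proof.
pose F n := cylinder step [:: true] `&`
  [set w | stays_positive (step ^~ w) (size [:: true]) n 2].
have -> : [set w | ~ contains_11_after_root (fun n => step n w)] =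
    \bigcap_n F n.
  apply/seteqP; split=> w /=.
    by move=> /avoids_11P [s0 sp] n _; split=> [[|]//|]; exact: sp.
  move=> h; apply/avoids_11P; split; last by move=> n; have [] := h n I.
  by have [/(_ 0%N isT)] := h 0%N I.
have mF n : measurable (F n).
  apply: measurableI; first exact: measurable_cylinder.
  exact: measurable_stays_positive.
have PF n : P (F n) = (p * survival p n 2)%:E.
  rewrite (probability_stays_positive p step) //.
  rewrite (probability_cylinder p step) //.
  by rewrite big_ord_recl big_ord0 mulr1 -EFinM.
rewrite -eternal_survival2 //.
(* Continuity from above: the events [F n] decrease. *)
have lim1 : (P \o F) @ \oo --> P (\bigcap_n F n).
  apply: nonincreasing_cvg_mu => //.
  - exact: le_lt_trans (probability_le1 P (mF 0%N)) (ltry 1).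
  - exact: bigcapT_measurable.
  - apply/nonincreasing_seqP => n; apply/subsetPset => w [c sp].
    by split=> //; exact: stays_positive_pred sp.
have lim2 : (P \o F) @ \oo --> (p * eternal_survival p 2)%:E.
  rewrite (_ : P \o F = EFin \o (fun n => p * survival p n 2)).
    apply: cvg_EFin; first exact: nearW.
    by apply: cvgM; [exact: cvg_cst|exact: cvg_survival].
  by apply/funext => n; exact: PF.
exact: cvg_unique lim1 lim2.
Qed.
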